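(* Suppose that $k$ is even and the $k$th order $n$-dimensional symmetric tensor $\mathcal{B}$ is positive definite. Let $\mathbf{x}_*\in\mathbb{S}^{n-1}$. Then $\mathbf{x}_*$ is a first-order stationary point, i.e. $\mathbf{g}(\mathbf{x}_* )=0$, if and only if $\mathbf{x}_*$ is an eigenvector corresponding to a certain eigenvalue, i.e. there is $\lambda\in\mathbb{R}$ with $\mathcal{T}\mathbf{x}_*^{k-1}=\lambda\,\mathcal{B}\mathbf{x}_*^{k-1}$. In fact, the eigenvalue is $f(\mathbf{x}_* )$.
   Context: Tensor notation: for a $k$th order $n$-dimensional real symmetric tensor $\mathcal{T}=(t_{i_1\cdots i_k})$ (entries invariant under permutations of indices) and $\mathbf{x}\in\mathbb{R}^n$, $\mathcal{T}\mathbf{x}^k=\sum_{i_1,\ldots,i_k=1}^n t_{i_1\cdots i_k}x_{i_1}\cdots x_{i_k}\in\mathbb{R}$, and $\mathcal{T}\mathbf{x}^{k-1}\in\mathbb{R}^n$ is the vector with $i$th entry $\sum_{i_2,\ldots,i_k=1}^n t_{ii_2\cdots i_k}x_{i_2}\cdots x_{i_k}$. Hypergraph tensors: $G=(V,E)$ is a $k$-uniform hypergraph with $V=\{1,\ldots,n\}$, $E$ a set of distinct $k$-element subsets of $V$ ($k\ge 2$), every vertex lying in at least one edge; $d(i)$ is the number of edges containing $i$. The adjacency tensor $\mathcal{A}$ has entries $a_{i_1\cdots i_k}=\frac{1}{(k-1)!}$ if $\{i_1,\ldots,i_k\}\in E$ and $0$ otherwise; the degree tensor $\mathcal{D}$ is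 the diagonal tensor with $i$th diagonal entry $d(i)$; the Laplacian tensor is $\mathcal{L}=\mathcal{D}-\mathcal{A}$ and the signless Laplacian tensor is $\mathcal{Q}=\mathcal{D}+\mathcal{A}$. The symmetric tensor $\mathcal{T}$ is one of $\mathcal{A},\mathcal{L},\mathcal{Q}$. $\mathcal{B}$ positive definite means $\mathcal{B}\mathbf{x}^k>0$ for all $\mathbf{x}\ne 0$ (examples: $\mathcal{B}\mathbf{x}^{k-1}=(x_i^{k-1})_i$, or $\mathcal{B}\mathbf{x}^{k-1}=(\mathbf{x}^\top\mathbf{x})^{k/2-1}\mathbf{x}$). A real $\lambda$ and nonzero $\mathbf{x}\in\mathbb{R}^n$ are called an eigenvalue and an associated eigenvector if $\mathcal{T}\mathbf{x}^{k-1}=\lambda\mathcal{B}\mathbf{x}^{k-1}$. $\mathbb{S}^{n-1}=\{\mathbf{x}\in\mathbb{R}^n:\mathbf{x}^\top\mathbf{x}=1\}$. The merit function is $f(\mathbf{x})=\frac{\mathcal{T}\mathbf{x}^k}{\mathcal{B}\mathbf{x}^k}$ and its gradient is $\mathbf{g}(\mathbf{x})=\frac{k}{\mathcal{B}\mathbf{x}^k}\left(\mathcal{T}\mathbf{x}^{k-1}-\frac{\mathcal{T}\mathbf{x}^k}{\mathcal{B}\mathbf{x}^k}\mathcal{B}\mathbf{x}^{k-1}\right)$, for $\mathbf{x}\neq 0$. *)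

(* Defs.v *)
From mathcomp Require Import all_boot all_order all_algebra.
From mathcomp Require Import all_classical all_reals all_analysis.

Set Implicit Arguments.
Unset Strict Implicit.
Unset Printing Implicit Defensive.

Import Order.TTheory GRing.Theory Num.Theory.
Import numFieldNormedType.Exports.

Local Open Scope ring_scope.

(* A tensor is the family of its entries, indexed by the multi-indices
   (i_1, ..., i_k); sums and differences of tensors are those of {ffun _}. *)
Definition tensor (R : realType) (k n : nat) := {ffun k.-tuple 'I_n -> R}.

Definition symmetric_tensor (R : realType) (k n : nat) (T : tensor R k n) :=
  forall s t : k.-tuple 'I_n, perm_eq s t -> T s = T t.

(* T x^k *)
Definition tensor_form (R : realType) (k n : nat) (T : tensor R k n)
    (x : 'rV[R]_n) : R :=
  \sum_(t : k.-tuple 'I_n) T t * \prod_(j <- t) x 0 j.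

(* T x^(k-1): for 0 < k, the multi-indices (i, i_2, ..., i_k) are the tuples
   with head i, and their behead is (i_2, ..., i_k). *)
Definition tensor_vec (R : realType) (k n : nat) (T : tensor R k n)
    (x : 'rV[R]_n) : 'rV[R]_n :=
  \row_i \sum_(t : k.-tuple 'I_n | ohead t == Some i)
    T t * \prod_(j <- behead t) x 0 j.

Definition positive_definite (R : realType) (k n : nat) (B : tensor R k n) :=
  forall x : 'rV[R]_n, x != 0 -> 0 < tensor_form B x.

Record uniform_hypergraph (k n : nat) := UniformHypergraph {
  edges : {set {set 'I_n}};
  edges_uniform : forall e, e \in edges -> #|e| = k;
  edges_cover : forall i : 'I_n, exists2 e, e \in edges & i \in e }.

Definition degree (k n : nat) (G : uniform_hypergraph k n) (i : 'I_n) : nat :=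
  #|[set e in edges G | i \in e]|.

Definition adjacency_tensor (R : realType) (k n : nat)
    (G : uniform_hypergraph k n) : tensor R k n :=
  [ffun t : k.-tuple 'I_n =>
     if [set i in t] \in edges G then ((k.-1)`!)%:R^-1 else 0].

(* For 0 < k, at most one i contributes to the sum, namely the i with
   t = (i, ..., i), if any. *)
Definition degree_tensor (R : realType) (k n : nat)
    (G : uniform_hypergraph k n) : tensor R k n :=
  [ffun t : k.-tuple 'I_n => \sum_(i | t == [tuple of nseq k i]) (degree G i)%:R].

Definition laplacian_tensor (R : realType) (k n : nat)
    (G : uniform_hypergraph k n) : tensor R k n :=
  degree_tensor R G - adjacency_tensor R G.

Definition signless_laplacian_tensor (R : realType) (k n : nat)
    (G : uniform_hypergraph k n) : tensor R k n :=
  degree_tensor R G + adjacency_tensor R G.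

Definition is_eigenpair (R : realType) (k n : nat) (T B : tensor R k n)
    (lam : R) (x : 'rV[R]_n) : Prop :=
  x != 0 /\ tensor_vec T x = lam *: tensor_vec B x.

Definition unit_sphere (R : realType) (n : nat) : set 'rV[R]_n :=
  [set x : 'rV[R]_n | \sum_i x 0 i ^+ 2 = 1]%classic.

Definition merit (R : realType) (k n : nat) (T B : tensor R k n)
    (x : 'rV[R]_n) : R :=
  tensor_form T x / tensor_form B x.

Definition merit_grad (R : realType) (k n : nat) (T B : tensor R k n)
    (x : 'rV[R]_n) : 'rV[R]_n :=
  (k%:R / tensor_form B x) *:
    (tensor_vec T x - (tensor_form T x / tensor_form B x) *: tensor_vec B x).

(* The library norm on 'rV[R]_n is the sup norm; differentiability does not
   depend on this choice, and v represents 'd f x for the dot product. *)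
Definition is_gradient (R : realType) (n : nat) (f : 'rV[R]_n -> R)
    (x v : 'rV[R]_n) : Prop :=
  differentiable f x /\ forall h : 'rV[R]_n, 'd f x h = \sum_i v 0 i * h 0 i.

(* Main.v *)
(** By symmetry of the tensor, the [k] partial products in the Leibniz rule
    for [T x^k] contribute equally, so its differential is
    [h |-> k (T x^(k-1)) . h]; the quotient rule then gives the gradient of the
    merit function.  Euler's identity [(T x^(k-1)) . x = T x^k], applied to both
    sides of the eigenvalue equation, forces the eigenvalue to be the value of
    the merit function, and the gradient vanishes exactly when the eigenvalue
    equation holds with that value. *)
From HB Require Import structures.
Require Import Defs.
From mathcomp Require Import all_boot all_order all_algebra.
From mathcomp Require Import perm.
From mathcomp Require Import all_classical all_reals all_analysis.
From mathcomp Require Import ring.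

Set Implicit Arguments.
Unset Strict Implicit.
Unset Printing Implicit Defensive.

Import Order.TTheory GRing.Theory Num.Theory numFieldNormedType.Exports.

Local Open Scope ring_scope.

Lemma is_diff_sum (R : realType) (V W : normedModType R) (I : Type)
    (r : seq I) (F dF : I -> V -> W) (x : V) :
  (forall i, is_diff x (F i) (dF i)) ->
  is_diff x (\sum_(i <- r) F i) (\sum_(i <- r) dF i).
Proof.
move=> dFP; elim: r => [|i r IHr].
  by rewrite !big_nil; exact: is_diff_cst.
by rewrite !big_cons; exact: is_diffD.
Qed.

(** Leibniz rule by induction on [r]. With [uniq r], the condition [i != m] drops exactly one
    factor; a repeated index would lose all its copies. *)
Lemma is_diff_prod (R : realType) (V : normedModType R) (I : eqType)
    (r : seq I) (F dF : I -> V -> R) (x : V) :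
  uniq r -> (forall i, is_diff x (F i) (dF i)) ->
  is_diff x (\prod_(i <- r) F i)
    (\sum_(m <- r) (\prod_(i <- r | i != m) F i x) *: dF m).
Proof.
move=> + dFP; elim: r => [|a r IHr] /=.
  by rewrite !big_nil; move=> _; exact: is_diff_cst.
move=> /andP[a_r /IHr {}IHr]; rewrite big_cons.
have := is_diffM (dFP a) IHr.
congr (is_diff_def _ _ _).
rewrite big_cons addrC; congr (_ + _).
  rewrite big_cons eqxx fct_prodE; congr (_ *: _).
  rewrite [RHS]big_seq_cond [LHS]big_seq; apply: eq_bigl => i.
  by case: eqP => [->|_]; rewrite ?(negPf a_r) ?andbT.
rewrite scaler_sumr [LHS]big_seq [RHS]big_seq; apply: eq_bigr => m m_r.
by rewrite big_cons ifT ?scalerA //; apply: contraNneq a_r => ->.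
Qed.

Lemma is_diff_coord (R : realType) (m n : nat) (M : 'M[R]_(m, n)) i j :
  is_diff M (fun N : 'M[R]_(m, n) => N i j) (fun N => N i j).
Proof.
have coord_lin : linear (fun N : 'M[R]_(m, n) => N i j : R).
  by move=> a A B; rewrite !mxE.
pose coordL := GRing.isLinear.Build _ _ _ _ _ coord_lin.
pose f : {linear 'M[R]_(m, n) -> R} := HB.pack (fun N : 'M[R]_(m, n) => N i j)
  coordL.
apply: DiffDef; first exact: differentiable_coord.
exact: (@diff_lin _ _ _ f M (@coord_continuous _ _ _ _ _)).
Qed.

(** Grouping the multi-indices by their head gives the left side. The right side has the shape of
    the Leibniz term at position [ord0]. *)
Lemma tensor_vec_dot (R : realType) (k n : nat) (T : tensor R k.+1 n)
    (x h : 'rV[R]_n) :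
  \sum_i tensor_vec T x 0 i * h 0 i =
  \sum_(t : k.+1.-tuple 'I_n)
    T t * ((\prod_(i | i != ord0) x 0 (tnth t i)) * h 0 (tnth t ord0)).
Proof.
rewrite [RHS](partition_big (fun t => tnth t ord0) predT) //=.
apply: eq_bigr => i _; rewrite mxE mulr_suml.
have headE (t : k.+1.-tuple 'I_n) : (ohead t == Some i) = (tnth t ord0 == i).
  by case/tupleP: t => a s.
apply: eq_big => [t|t]; rewrite headE // => /eqP <-; rewrite mulrA.
congr (_ * _ * _); case/tupleP: t => a s.
rewrite [behead _]/= big_tuple [RHS]big_mkcond big_ord_recl /= mul1r.
by apply: eq_bigr => j _; rewrite tnthS.
Qed.

(** Taking [h = x] in [tensor_vec_dot] restores the missing factor of each monomial. *)
Lemma tensor_vec_euler (R : realType) (k n : nat) (T : tensor R k n)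
    (x : 'rV[R]_n) :
  (0 < k)%N -> \sum_i tensor_vec T x 0 i * x 0 i = tensor_form T x.
Proof.
case: k T => // k T _; rewrite tensor_vec_dot; apply: eq_bigr => t _.
by rewrite big_tuple [in RHS](bigD1 ord0) //= [_ * x _ _]mulrC.
Qed.

Lemma is_diff_tensor_form (R : realType) (k n : nat) (T : tensor R k n)
    (x : 'rV[R]_n) :
  (0 < k)%N -> symmetric_tensor T ->
  is_diff x (tensor_form T)
    (fun h => k%:R * \sum_i tensor_vec T x 0 i * h 0 i).
Proof.
case: k T => // k T _ T_sym.
(* The factors are indexed by positions rather than by the entries of [t], so uniqueness holds even
   when [t] repeats a vertex. *)
have dmonomial (t : k.+1.-tuple 'I_n) := is_diffZ (T t)
  (is_diff_prod (index_enum_uniq 'I_k.+1)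
    (fun i => is_diff_coord x 0 (tnth t i))).
have := is_diff_sum (index_enum _) dmonomial.
have -> : \sum_t T t *: \prod_i (fun y : 'rV[R]_n => y 0 (tnth t i)) =
    tensor_form T.
  apply/funext => y; rewrite fct_sumE; apply: eq_bigr => t _.
  by rewrite big_tuple /= fct_prodE.
congr (is_diff_def _ _ _); apply/funext => h; rewrite tensor_vec_dot fct_sumE.
(* With the differentiated position [m] outermost, it remains to see that the inner sum does not
   depend on [m]. *)
transitivity (\sum_(m < k.+1) \sum_(t : k.+1.-tuple 'I_n)
    T t * ((\prod_(i | i != m) x 0 (tnth t i)) * h 0 (tnth t m))).
  rewrite exchange_big; apply: eq_bigr => t _ /=.
  by rewrite -mulr_sumr; congr (_ * _); rewrite fct_sumE.
rewrite mulr_natl -iter_addr_0 -big_const_ord; apply: eq_bigr => m _.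
(* Swapping positions 0 and m turns the m-th partial derivative into the 0-th. *)
pose swap (t : k.+1.-tuple 'I_n) := [tuple tnth t (tperm ord0 m i) | i < k.+1].
have swapK : involutive swap.
  by move=> t; apply: eq_from_tnth => i; rewrite !tnth_mktuple tpermK.
rewrite (reindex_inj (inv_inj swapK)) /=; apply: eq_bigr => t _.
have -> : T (swap t) = T t.
  by apply: T_sym; apply/tuple_permP; exists (tperm ord0 m).
(* The same transposition reindexes the product, moving the omitted position from [m] to [ord0]. *)
rewrite tnth_mktuple tpermR (reindex_inj (@perm_inj _ (tperm ord0 m))) /=.
congr (_ * (_ * _)); apply: eq_big => i.
  by rewrite (canF_eq (tpermK _ _)) tpermR.
by move=> _; rewrite tnth_mktuple tpermK.
Qed.

Lemma adjacency_tensor_sym (R : realType) (k n : nat)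
    (G : uniform_hypergraph k n) : symmetric_tensor (adjacency_tensor R G).
Proof.
move=> s t st; rewrite !ffunE; suff -> : finset (mem s) = finset (mem t) by [].
by apply/setP => i; rewrite !inE (perm_mem st).
Qed.

Lemma degree_tensor_sym (R : realType) (k n : nat)
    (G : uniform_hypergraph k n) : symmetric_tensor (degree_tensor R G).
Proof.
move=> s t st; rewrite !ffunE; apply: eq_bigl => i.
have nseqP (u : k.-tuple 'I_n) :
    (u == [tuple of nseq k i]) = all (pred1 i) u.
  by rewrite -val_eqE (sameP (all_pred1P i u) eqP) (size_tuple u).
by rewrite !nseqP (perm_all _ st).
Qed.

Lemma tensor_vec_eq_merit (R : realType) (k n : nat) (T B : tensor R k n)
    (lam : R) (x : 'rV[R]_n) :
  (0 < k)%N -> tensor_form B x != 0 ->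
  tensor_vec T x = lam *: tensor_vec B x -> lam = merit T B x.
Proof.
move=> k_gt0 Bx0 TB; rewrite /merit -(tensor_vec_euler T) // TB.
under eq_bigr do rewrite mxE -mulrA.
by rewrite -mulr_sumr tensor_vec_euler // mulfK.
Qed.

Lemma merit_is_gradient (R : realType) (k n : nat) (T B : tensor R k n)
    (x : 'rV[R]_n) :
  (0 < k)%N -> symmetric_tensor T -> symmetric_tensor B ->
  tensor_form B x != 0 -> is_gradient (merit T B) x (merit_grad T B x).
Proof.
move=> k_gt0 T_sym B_sym Bx0.
have [dB dBE] := is_diff_tensor_form x k_gt0 B_sym.
have [dM dME] := is_diffM (is_diff_tensor_form x k_gt0 T_sym)
  (differentiableP (differentiableV dB Bx0)).
split=> [|h]; first exact: dM.
have -> : merit T B = tensor_form T * (fun y => (tensor_form B y)^-1) by [].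
rewrite dME (diffV dB Bx0) dBE.
(* This is the quotient rule with [k%:R / tensor_form B x] factored out; the two dot products stay
   opaque for [field]. *)
transitivity (k%:R / tensor_form B x * (\sum_i tensor_vec T x 0 i * h 0 i
  - tensor_form T x / tensor_form B x * \sum_i tensor_vec B x 0 i * h 0 i)).
  rewrite fctE -[LHS]/(_ * (_ * (_ * _)) + _ * (_ * _)).
  set dTh := \sum_i tensor_vec T x 0 i * h 0 i.
  by set dBh := \sum_i tensor_vec B x 0 i * h 0 i; field.
rewrite mulr_sumr -sumrB mulr_sumr; apply: eq_bigr => i _.
rewrite !mxE; ring.
Qed.

Theorem theorem4p1 (R : realType) (k n : nat) (hk : (2 <= k)%N)
  (k_even : ~~ odd k) (G : uniform_hypergraph k n) (T B : tensor R k n)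
  (hT : [\/ T = adjacency_tensor R G, T = laplacian_tensor R G
          | T = signless_laplacian_tensor R G])
  (B_sym : symmetric_tensor B) (B_pd : positive_definite B)
  (x : 'rV[R]_n) (x_sphere : unit_sphere x) :
  [/\ is_gradient (merit T B) x (merit_grad T B x),
      merit_grad T B x = 0 <-> (exists lam : R, is_eigenpair T B lam x)
    & forall lam : R, is_eigenpair T B lam x -> lam = merit T B x].
Proof.
have k_gt0 : (0 < k)%N by exact: ltnW.
have x0 : x != 0.
  apply/eqP => x0; move: x_sphere; rewrite /unit_sphere /= x0.
  rewrite big1 => [/esym/eqP|i _]; first by rewrite oner_eq0.
  by rewrite mxE expr0n.
have Bx0 : tensor_form B x != 0 by rewrite gt_eqF // B_pd.
have T_sym : symmetric_tensor T.
  have A_sym := adjacency_tensor_sym R G.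
  have D_sym := degree_tensor_sym R G.
  by case: hT => -> // s t st; move: (D_sym s t st) (A_sym s t st);
    rewrite !ffunE => -> ->.
split; first exact: merit_is_gradient.
- split=> [/eqP|[lam [_ TB]]].
    (* The scalar prefactor is nonzero, so the bracket vanishes, which is the eigenvalue equation
       for [merit T B x]. *)
    rewrite scaler_eq0 mulf_eq0 invr_eq0 (negPf Bx0) pnatr_eq0 gtn_eqF //=.
    by rewrite subr_eq0 => /eqP TB; exists (merit T B x).
  rewrite /merit_grad -/(merit T B x).
  by rewrite -(tensor_vec_eq_merit k_gt0 Bx0 TB) TB subrr scaler0.
- by move=> lam [_]; exact: tensor_vec_eq_merit.
Qed.
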